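(* Let $s\in\{0,\tfrac12\}$ and $\lambda\in\mathbb{C}$, and let $\mathfrak{L}=\mathfrak{L}^s_\lambda$. Then the space of all superderivations of $\mathfrak{L}$ decomposes as $$\mathrm{Der}(\mathfrak{L})=\mathrm{Inn}(\mathfrak{L})\oplus\mathbb{C}\,\partial_G\oplus\delta_{\lambda,0}\,\mathbb{C}\,\partial_D ,$$ where $\delta_{\lambda,0}\mathbb{C}\partial_D$ denotes $\mathbb{C}\partial_D$ if $\lambda=0$ and $\{0\}$ if $\lambda\neq0$. (In the paper, $\partial_G$ is called $\partial_2$ for $s=0$ and $\partial_4$ for $s=\tfrac12$; $\partial_D$ is called $\partial_1$ for $s=0$ and $\partial_3$ for $s=\tfrac12$.)
   Context: Fix $s\in\{0,\tfrac12\}$ and $\lambda\in\mathbb{C}$. The deformative super $W$-algebra $\mathfrak{L}=\mathfrak{L}^s_\lambda=W^s_\lambda(2,2)$ is the complex Lie superalgebra with basis $\{L_m,I_m,G_p,H_p : m\in\mathbb{Z},\ p\in s+\mathbb{Z}\}$, even part $\mathfrak{L}_{\bar0}=\mathrm{span}\{L_m,I_m\}$, odd part $\mathfrak{L}_{\bar1}=\mathrm{span}\{G_p,H_p\}$, and brackets of basis elements given by $[L_m,L_n]=(m-n)L_{m+n}$, $[L_m,I_n]=(m-n)I_{m+n}$, $[L_m,H_p]=(\tfrac m2-p)H_{m+p}$, $[L_m,G_p]=(\tfrac m2-p)G_{m+p}+\lambda(m+1)H_{m+p}$, $[I_m,G_p]=(m-2p)H_{m+p}$, $[G_p,G_q]=I_{p+q}$,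 together with those obtained by super-antisymmetry $[y,x]=-(-1)^{|x||y|}[x,y]$; all other brackets of basis elements vanish (e.g. $[I_m,I_n]=[I_m,H_p]=[G_p,H_q]=[H_p,H_q]=0$). For homogeneous $x$, $|x|\in\mathbb{Z}_2$ denotes its parity. A superderivation of parity $a\in\mathbb{Z}_2$ is a linear map $D:\mathfrak{L}\to\mathfrak{L}$ with $D(\mathfrak{L}_{b})\subset\mathfrak{L}_{a+b}$ and $D([x,y])=[D(x),y]+(-1)^{a|x|}[x,D(y)]$ for homogeneous $x,y$; $\mathrm{Der}(\mathfrak{L})=\mathrm{Der}_{\bar0}(\mathfrak{L})\oplus\mathrm{Der}_{\bar1}(\mathfrak{L})$ is the space of sums of an even and an odd superderivation. $\mathrm{Inn}(\mathfrak{L})=\{\mathrm{ad}\,x: x\in\mathfrak{L}\}$, where $\mathrm{ad}\,x(y)=[x,y]$ (extended linearly from homogeneous $x$). The linear maps $\partial_G$ and $\partial_D$ are defined by: $\partial_G(L_m)=\partial_G(I_m)=\partial_G(H_p)=0$, $\partial_G(G_p)=H_p$; and $\partial_D(L_m)=0$, $\partial_D(I_m)=2I_m$, $\partial_D(G_p)=G_p$, $\partial_D(H_p)=3H_p$ (for all $m\in\mathbb{Z}$, $p\in s+\mathbb{Z}$). *)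

(* Defs.v *)
From HB Require Import structures.
From mathcomp Require Import all_boot all_order all_algebra.
Unset Printing Implicit Defensive.
Import Order.TTheory GRing.Theory Num.Theory.
Local Open Scope ring_scope.

(* Kinds of basis vectors: L_m, I_m (even), G_p, H_p (odd). *)
Inductive gen := GL | GI | GG | GH.
Definition gen_eqb (a b : gen) : bool :=
  match a, b with
  | GL, GL | GI, GI | GG, GG | GH, GH => true
  | _, _ => false end.
Lemma gen_eqP : Equality.axiom gen_eqb.
Proof. by case; case; constructor. Qed.
HB.instance Definition _ := hasDecEq.Build gen gen_eqP.

(* A basis vector (g, n): for g = GL, GI it is L_n / I_n (n = m);
   for g = GG, GH it is G_p / H_p with p = n + s. *)
Definition basis := (gen * int)%type.

(* parity of a basis vector: true = odd *)
Definition par (b : basis) : bool :=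
  match b.1 with GG | GH => true | _ => false end.

(* Elements of L are represented as formal finite linear combinations
   of basis vectors; two representations denote the same element iff
   all their coefficients agree. *)
Definition vec (K : numClosedFieldType) := seq (K * basis)%type.

Definition coef {K : numClosedFieldType} (v : vec K) (b : basis) : K :=
  \sum_(x <- v | x.2 == b) x.1.

Definition veq {K : numClosedFieldType} (v w : vec K) : Prop :=
  forall b, coef v b = coef w b.

Definition vscale {K : numClosedFieldType} (c : K) (v : vec K) : vec K :=
  [seq (c * x.1, x.2) | x <- v].

(* v is homogeneous of parity a (0 is homogeneous of every parity) *)
Definition vpar {K : numClosedFieldType} (a : bool) (v : vec K) : Prop :=
  forall b, coef v b != 0 -> par b = a.

Definition sval (K : numClosedFieldType) (half : bool) : K :=
  if half then 2^-1 else 0.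
Definition pv (K : numClosedFieldType) (half : bool) (k : int) : K :=
  k%:~R + sval K half.
(* index of G_{p+q} ... : (k + s) + (l + s) = (k + l + 2s) *)
Definition shift (half : bool) : int := if half then 1 else 0.

Definition bb {K : numClosedFieldType} (half : bool) (lam : K)
    (b1 b2 : basis) : vec K :=
  let (g1, m) := b1 in let (g2, n) := b2 in
  match g1, g2 with
  | GL, GL => [:: ((m - n)%:~R, (GL, m + n))]
  | GL, GI => [:: ((m - n)%:~R, (GI, m + n))]
  | GI, GL => [:: (- (n - m)%:~R, (GI, n + m))]
  | GL, GH => [:: (m%:~R / 2 - pv K half n, (GH, m + n))]
  | GH, GL => [:: (- (n%:~R / 2 - pv K half m), (GH, n + m))]
  | GL, GG => [:: (m%:~R / 2 - pv K half n, (GG, m + n));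
                  (lam * (m%:~R + 1), (GH, m + n))]
  | GG, GL => [:: (- (n%:~R / 2 - pv K half m), (GG, n + m));
                  (- (lam * (n%:~R + 1)), (GH, n + m))]
  | GI, GG => [:: (m%:~R - 2 * pv K half n, (GH, m + n))]
  | GG, GI => [:: (- (n%:~R - 2 * pv K half m), (GH, n + m))]
  | GG, GG => [:: (1, (GI, m + n + shift half))]
  | _, _ => [::]
  end.

Definition br {K : numClosedFieldType} (half : bool) (lam : K)
    (v w : vec K) : vec K :=
  flatten [seq vscale (x.1 * y.1) (bb half lam x.2 y.2) | x <- v, y <- w].

(* Linear maps L -> L, given by their values on the basis. *)
Definition lmap (K : numClosedFieldType) := basis -> vec K.

Definition lapp {K : numClosedFieldType} (D : lmap K) (v : vec K) : vec K :=
  flatten [seq vscale x.1 (D x.2) | x <- v].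

Definition lequ {K : numClosedFieldType} (D E : lmap K) : Prop :=
  forall b, veq (D b) (E b).
Definition ladd {K : numClosedFieldType} (D E : lmap K) : lmap K :=
  fun b => D b ++ E b.
Definition lscale {K : numClosedFieldType} (c : K) (D : lmap K) : lmap K :=
  fun b => vscale c (D b).
Definition lzero (K : numClosedFieldType) : lmap K := fun _ => [::].

Definition superder {K : numClosedFieldType} (half : bool) (lam : K)
    (a : bool) (D : lmap K) : Prop :=
  (forall (c : bool) (x : vec K), vpar c x -> vpar (addb c a) (lapp D x)) /\
  (forall (c d : bool) (x y : vec K), vpar c x -> vpar d y ->
     veq (lapp D (br half lam x y))
         (br half lam (lapp D x) y ++
          vscale (if a && c then -1 else 1) (br half lam x (lapp D y)))).

Definition isDer {K : numClosedFieldType} (half : bool) (lam : K)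
    (D : lmap K) : Prop :=
  exists D0 D1, superder half lam false D0 /\ superder half lam true D1 /\
                lequ D (ladd D0 D1).

Definition ad {K : numClosedFieldType} (half : bool) (lam : K)
    (x : vec K) : lmap K :=
  fun b => br half lam x [:: (1, b)].

Definition partialG (K : numClosedFieldType) : lmap K :=
  fun b => match b with (GG, k) => [:: (1, (GH, k))] | _ => [::] end.

Definition partialD (K : numClosedFieldType) : lmap K :=
  fun b => match b.1 with
           | GL => [::] | GI => [:: (2, b)] | GG => [:: (1, b)]
           | GH => [:: (3, b)] end.

Definition decomp {K : numClosedFieldType} (half : bool) (lam : K)
    (x : vec K) (a b : K) : lmap K :=
  ladd (ad half lam x) (ladd (lscale a (partialG K)) (lscale b (partialD K))).

(* Main.v *)
(** [ad L_0] acts as minus the degree plus the square-zero map [lam * partialG],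
    hence is invertible in nonzero degrees.  Subtracting one inner derivation
    makes [D L_0] homogeneous of degree 0, and the Leibniz rule for [[L_0, x]]
    then shows that [D] preserves the degree; for [s = 1/2] this kills odd [D],
    which shift degrees by half-integers.  Subtracting [ad] of a degree-0
    element normalises [D L_1] to 0, the Witt relations propagate this to all
    [L_m], and [D] then commutes with every [ad L_m].  The remaining brackets
    determine [D] up to its eigenvalue on [G] and the [H]-component of [D G];
    the bracket [[L_0, G_p]] forces [lam] times the eigenvalue to vanish. *)
Require Import Defs.
From HB Require Import structures.
From mathcomp Require Import all_boot all_order all_algebra.
From mathcomp Require Import ring zify.
Import Order.TTheory GRing.Theory Num.Theory.
Local Open Scope ring_scope.

(** * Linear functionals on formal combinations, and reduction to basis vectors *)

(** The linear functional with values [phi] on the basis. Testing formal sums against all such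
    functionals turns brackets and linear maps into nested [ev], with no coordinates to track. *)
Definition ev {K : numClosedFieldType} (phi : basis -> K) (v : vec K) : K :=
  \sum_(x <- v) x.1 * phi x.2.

Lemma ev_nil (K : numClosedFieldType) (phi : basis -> K) : ev phi [::] = 0.
Proof. exact: big_nil. Qed.

Lemma ev_cons (K : numClosedFieldType) (phi : basis -> K) x (v : vec K) :
  ev phi (x :: v) = x.1 * phi x.2 + ev phi v.
Proof. exact: big_cons. Qed.

Lemma ev_cat (K : numClosedFieldType) (phi : basis -> K) (v w : vec K) :
  ev phi (v ++ w) = ev phi v + ev phi w.
Proof. exact: big_cat. Qed.

Lemma ev_scale (K : numClosedFieldType) (phi : basis -> K) c (v : vec K) :
  ev phi (vscale c v) = c * ev phi v.
Proof. by rewrite /ev big_map mulr_sumr; apply: eq_bigr => x _; rewrite mulrA. Qed.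

Definition sgn (K : numClosedFieldType) (e : bool) : K := if e then -1 else 1.

Lemma ev_lapp (K : numClosedFieldType) (phi : basis -> K) (D : lmap K)
    (v : vec K) : ev phi (lapp D v) = ev (fun b => ev phi (D b)) v.
Proof.
elim: v => [|x v IH]; first by rewrite !ev_nil.
by rewrite ev_cons -IH /lapp /= ev_cat ev_scale.
Qed.

Lemma ev_br (K : numClosedFieldType) (half : bool) (lam : K)
    (phi : basis -> K) (v w : vec K) :
  ev phi (br half lam v w) =
  ev (fun b => ev (fun c => ev phi (bb half lam b c)) w) v.
Proof.
rewrite /br; elim: v => [|x v IH]; first by rewrite !ev_nil.
rewrite ev_cons -IH /= flatten_cat ev_cat; congr (_ + _).
elim: w {IH} => [|y w IHw]; first by rewrite !ev_nil mulr0.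
by rewrite /= ev_cat ev_cons IHw ev_scale mulrDr mulrA.
Qed.

Lemma eq_ev (K : numClosedFieldType) (phi psi : basis -> K) (v : vec K) :
  phi =1 psi -> ev phi v = ev psi v.
Proof. by move=> e; apply: eq_bigr => x _; rewrite e. Qed.

Lemma ev_addf (K : numClosedFieldType) (phi psi : basis -> K) (v : vec K) :
  ev (fun b => phi b + psi b) v = ev phi v + ev psi v.
Proof. by rewrite /ev -big_split; apply: eq_bigr => x _; rewrite mulrDr. Qed.

Lemma ev_scalef (K : numClosedFieldType) (phi : basis -> K) (k : K)
    (v : vec K) : ev (fun b => k * phi b) v = k * ev phi v.
Proof. by rewrite /ev mulr_sumr; apply: eq_bigr => x _; rewrite mulrCA. Qed.

Lemma exchange_ev (K : numClosedFieldType) (f : basis -> basis -> K)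
    (v w : vec K) :
  ev (fun b => ev (f b) w) v = ev (fun c => ev (f^~ c) v) w.
Proof.
rewrite /ev; under eq_bigr do rewrite mulr_sumr.
rewrite exchange_big; apply: eq_bigr => y _; rewrite mulr_sumr.
by apply: eq_bigr => x _; rewrite mulrCA.
Qed.

Lemma coef_ev (K : numClosedFieldType) (v : vec K) (b : basis) :
  coef v b = ev (fun c => (c == b)%:R) v.
Proof.
by rewrite /coef big_mkcond; apply: eq_bigr => x _; case: eqP;
  rewrite ?mulr1 ?mulr0.
Qed.

Lemma ev_coef (K : numClosedFieldType) (phi : basis -> K) (v : vec K)
    (S : seq basis) :
  uniq S -> {subset [seq x.2 | x <- v] <= S} ->
  ev phi v = \sum_(b <- S) coef v b * phi b.
Proof.
move=> uS; elim: v => [|x v IH] sub.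
  by rewrite ev_nil big1 // => b _; rewrite coef_ev ev_nil mul0r.
rewrite ev_cons IH => [|b bv]; last by apply: sub; rewrite in_cons bv orbT.
have xS : x.2 \in S by apply: sub; rewrite in_cons eqxx.
have -> : x.1 * phi x.2 = \sum_(b <- S) x.1 * (x.2 == b)%:R * phi b.
  rewrite (bigD1_seq _ xS uS) /= eqxx mulr1 big1 ?addr0 // => b.
  by rewrite eq_sym => /negPf ->; rewrite mulr0 mul0r.
by rewrite -big_split; apply: eq_bigr => b _; rewrite !coef_ev ev_cons mulrDl.
Qed.

Lemma ev_supp (K : numClosedFieldType) (v : vec K) :
  exists S, forall phi, ev phi v = \sum_(b <- S) coef v b * phi b.
Proof.
exists (undup [seq x.2 | x <- v]) => phi; apply: ev_coef => [|b].
  exact: undup_uniq.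
by rewrite mem_undup.
Qed.

(** Forward, both sums are collected over one common duplicate-free support; backward, [phi] is the
    indicator of a basis vector. *)
Lemma veqP (K : numClosedFieldType) (v w : vec K) :
  veq v w <-> forall phi, ev phi v = ev phi w.
Proof.
split=> [e phi|e b]; last by rewrite !coef_ev.
pose S := undup [seq x.2 | x <- v ++ w].
have uS : uniq S by apply: undup_uniq.
by rewrite !(ev_coef _ _ _ S) //; first (by apply: eq_bigr => b _; rewrite e);
  move=> b bv; rewrite mem_undup map_cat mem_cat bv ?orbT.
Qed.

(* Superderivations by their structure equations on basis vectors, tested
   against arbitrary linear functionals [phi] instead of coordinatewise. *)
Definition bder {K : numClosedFieldType} (half : bool) (lam : K) (a : bool)
    (D : lmap K) : Prop :=
  (forall b, vpar (par b (+) a) (D b)) /\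
  (forall b1 b2 phi,
     ev (fun b => ev phi (D b)) (bb half lam b1 b2) =
     ev (fun b => ev phi (bb half lam b b2)) (D b1) +
     sgn K (a && par b1) * ev (fun b => ev phi (bb half lam b1 b)) (D b2)).

Lemma ev1 (K : numClosedFieldType) (phi : basis -> K) b :
  ev phi [:: (1, b)] = phi b.
Proof. by rewrite ev_cons ev_nil mul1r addr0. Qed.

(** Bilinearity: the basis vectors with nonzero coefficient in a homogeneous vector all have its
    parity, so the sign in the Leibniz rule is the same for all of them. *)
Lemma superderP (K : numClosedFieldType) (half : bool) (lam : K) (a : bool)
    (D : lmap K) : superder half lam a D <-> bder half lam a D.
Proof.
have par1 b : vpar (par b) [:: (1 : K, b)].
  move=> c; rewrite coef_ev ev1; case: (b =P c) => [->|] //.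
  by rewrite eqxx.
split=> [[D1 D2]|[D1 D2]]; split.
- move=> b c; have := D1 _ _ (par1 b) c.
  by rewrite !coef_ev ev_lapp ev1.
- move=> b1 b2 phi; have /veqP/(_ phi) := D2 _ _ _ _ (par1 b1) (par1 b2).
  rewrite ev_lapp ev_cat ev_scale !(ev_br, ev_lapp, ev1) => ->.
  by congr (_ + _); apply: eq_ev => b; rewrite ev1.
- move=> c x xc e; rewrite coef_ev ev_lapp.
  have [S ->] := ev_supp _ x => nz; apply: contraTeq isT => ne; move/eqP: nz.
  case; apply: big1 => b _; rewrite -coef_ev.
  have [->|/xc bc] := eqVneq (coef x b) 0; first by rewrite mul0r.
  have [->|/D1] := eqVneq (coef (D b) e) 0; first by rewrite mulr0.
  by rewrite bc => /eqP; rewrite (negPf ne).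
move=> c d x y xc yd; apply/veqP => phi.
rewrite ev_lapp ev_cat ev_scale !ev_br !ev_lapp.
have [S xS] := ev_supp _ x; rewrite !xS mulr_sumr -big_split /=.
apply: eq_bigr => b _.
have [->|/xc bc] := eqVneq (coef x b) 0; first by rewrite !mul0r mulr0 addr0.
rewrite mulrCA -mulrDr; congr (_ * _).
under eq_ev do rewrite D2 bc.
by rewrite ev_addf ev_scalef ev_lapp [in RHS]exchange_ev.
Qed.

(** * Jacobi identity; the listed sums are superderivations *)

(** [field] treats each [phi (g, i)] as an atom, so indices that agree only up to ring laws in [int]
    are first made syntactically equal. *)
Ltac same_index phi := repeat match goal with
  | |- context [phi (?g, ?i)] =>
    match goal with |- context [phi (g, ?j)] =>
       assert_fails (constr_eq i j);
       have -> : j = i by ring end end.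

Lemma jacobi (K : numClosedFieldType) (half : bool) (lam : K)
    (c b1 b2 : basis) (phi : basis -> K) :
  ev (fun b => ev phi (bb half lam c b)) (bb half lam b1 b2) =
  ev (fun b => ev phi (bb half lam b b2)) (bb half lam c b1) +
  sgn K (par c && par b1) *
    ev (fun b => ev phi (bb half lam b1 b)) (bb half lam c b2).
Proof.
case: c b1 b2 => [[] l] [[] m] [[] n]; rewrite /sgn /bb /par /= ?ev_cons ?ev_nil
  /= ?ev_cons ?ev_nil /= ?(mulr0, addr0) //; rewrite /pv /Defs.sval.
all: case: half => /=.
all: match goal with phi : basis -> _ |- _ => same_index phi end.
all: by field; rewrite ?pnatr_eq0.
Qed.

Lemma ev_ad (K : numClosedFieldType) (half : bool) (lam : K) (y : vec K) b phi :
  ev phi (ad half lam y b) = ev (fun c => ev phi (bb half lam c b)) y.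
Proof. by rewrite /ad ev_br; apply: eq_ev => c; rewrite ev1. Qed.

Lemma coef_mem (K : numClosedFieldType) (v : vec K) b :
  coef v b != 0 -> b \in [seq x.2 | x <- v].
Proof.
move=> nz; apply: contraNT nz => nb; apply/eqP; apply: big1_seq => x /andP[/eqP xb xv].
by move: nb; rewrite -xb map_f.
Qed.

Lemma vpar_all (K : numClosedFieldType) a (v : vec K) :
  all (fun x => par x.2 == a) v -> vpar a v.
Proof.
by move=> /allP av b /coef_mem/mapP[x xv ->]; apply/eqP/(av _ xv).
Qed.

Lemma vpar_bb (K : numClosedFieldType) (half : bool) (lam : K) b1 b2 :
  vpar (par b1 (+) par b2) (bb half lam b1 b2).
Proof. by apply: vpar_all; case: b1 b2 => [[] m] [[] n]. Qed.

Lemma vpar_cat (K : numClosedFieldType) a (v w : vec K) :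
  vpar a v -> vpar a w -> vpar a (v ++ w).
Proof.
move=> va wa b; rewrite coef_ev ev_cat -!coef_ev.
have [->|/va //] := eqVneq (coef v b) 0.
by rewrite add0r => /wa.
Qed.

Lemma vpar_scale (K : numClosedFieldType) a k (v : vec K) :
  vpar a v -> vpar a (vscale k v).
Proof.
move=> va b; rewrite coef_ev ev_scale -coef_ev => nz; apply: va.
by apply: contraNneq nz => ->; rewrite mulr0.
Qed.

Lemma bder_add (K : numClosedFieldType) (half : bool) (lam : K) a
    (D E : lmap K) :
  bder half lam a D -> bder half lam a E -> bder half lam a (ladd D E).
Proof.
move=> [D1 D2] [E1 E2]; split=> [b|b1 b2 phi].
  by apply: vpar_cat; [apply: D1 | apply: E1].
rewrite /ladd !ev_cat; under eq_ev do rewrite ev_cat.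
by rewrite ev_addf D2 E2; ring.
Qed.

Lemma bder_scale (K : numClosedFieldType) (half : bool) (lam : K) a k
    (D : lmap K) :
  bder half lam a D -> bder half lam a (lscale k D).
Proof.
move=> [D1 D2]; split=> [b|b1 b2 phi]; first exact/vpar_scale/D1.
rewrite /lscale !ev_scale; under eq_ev do rewrite ev_scale.
by rewrite ev_scalef D2; ring.
Qed.

Lemma bder_ad (K : numClosedFieldType) (half : bool) (lam : K) a (y : vec K) :
  all (fun x => par x.2 == a) y -> bder half lam a (ad half lam y).
Proof.
move=> ya; split=> [b c|b1 b2 phi].
  move=> nz; apply/eqP; apply: contraNT nz => ne.
  rewrite coef_ev ev_ad; apply/eqP; apply: big1_seq => x /= xy; apply/eqP.
  have /eqP xa := allP ya _ xy.
  rewrite mulf_eq0; apply/orP; right; rewrite -coef_ev.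
  by apply: contraNT ne => /vpar_bb ->; rewrite xa addbC.
rewrite !ev_ad; under eq_ev do rewrite ev_ad.
rewrite exchange_ev -ev_scalef -ev_addf; apply: eq_big_seq => x xy.
by have /eqP <- := allP ya _ xy; rewrite jacobi.
Qed.

(** Valid for every [lam]: [L_m] acts on H with the coefficient of its G to G part, and H brackets
    to zero with I, G and H. *)
Lemma bder_partialG (K : numClosedFieldType) (half : bool) (lam : K) :
  bder half lam false (partialG K).
Proof.
split=> [[[] m]|[[] m] [[] n] phi]; try by apply: vpar_all.
all: rewrite /sgn /bb /par /= ?ev_cons ?ev_nil /= ?ev_cons ?ev_nil /=
   ?(mulr0, addr0, add0r) //=.
all: by ring.
Qed.

(** The weights 0, 1, 2, 3 of L, G, I, H add up under every bracket except in the [lam] term of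
    [[L_m, G_p]], which is absent here. *)
Lemma bder_partialD (K : numClosedFieldType) (half : bool) :
  bder half (0 : K) false (partialD K).
Proof.
split=> [[[] m]|[[] m] [[] n] phi]; try by apply: vpar_all.
all: rewrite /sgn /bb /par /= ?ev_cons ?ev_nil /= ?ev_cons ?ev_nil /=
   ?(mulr0, addr0, add0r) //=.
all: by ring.
Qed.

Lemma bder_decomp (K : numClosedFieldType) (half : bool) (lam : K)
    (y : vec K) (k l : K) :
  (lam != 0 -> l = 0) -> all (fun x => par x.2 == false) y ->
  bder half lam false (decomp half lam y k l).
Proof.
move=> h ye; apply: bder_add; first exact: bder_ad.
apply: bder_add; first exact/bder_scale/bder_partialG.
have [->|/h ->] := eqVneq lam 0; first exact/bder_scale/bder_partialD.
split=> [b c|b1 b2 phi]; first by rewrite coef_ev ev_scale mul0r eqxx.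
rewrite /lscale !ev_scale; under eq_ev do rewrite ev_scale.
by rewrite ev_scalef !mul0r mulr0 addr0.
Qed.

Lemma ev_split_parity (K : numClosedFieldType) (phi : basis -> K) (v : vec K) :
  ev phi v = ev phi [seq x <- v | par x.2 == false] +
             ev phi [seq x <- v | par x.2 == true].
Proof.
elim: v => [|x v IH]; first by rewrite !ev_nil addr0.
by rewrite ev_cons IH /=; case: (par x.2); rewrite /= !ev_cons; ring.
Qed.

Lemma isDer_decomp (K : numClosedFieldType) (half : bool) (lam : K)
    (x : vec K) (a b : K) :
  (lam != 0 -> b = 0) -> isDer half lam (decomp half lam x a b).
Proof.
move=> h.
exists (decomp half lam [seq t <- x | par t.2 == false] a b),
       (ad half lam [seq t <- x | par t.2 == true]).
split; first by apply/superderP/bder_decomp => //; apply: filter_all.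
split; first by apply/superderP/bder_ad; apply: filter_all.
move=> c; apply/veqP => phi; rewrite /decomp /ladd !ev_cat !ev_ad.
by rewrite ev_split_parity; ring.
Qed.

(** * Directness of the sum *)

Lemma coef_ad_L (K : numClosedFieldType) (half : bool) (lam : K)
    (x : vec K) (m n : int) :
  [/\ coef (ad half lam x (GL, m)) (GL, n + m) = (n - m)%:~R * coef x (GL, n),
      coef (ad half lam x (GL, m)) (GI, n + m) = (n - m)%:~R * coef x (GI, n),
      coef (ad half lam x (GL, m)) (GG, n + m) =
        (pv K half n - m%:~R / 2) * coef x (GG, n)
    & coef (ad half lam x (GL, m)) (GH, n + m) =
        (pv K half n - m%:~R / 2) * coef x (GH, n)
        - lam * (m%:~R + 1) * coef x (GG, n)].
Proof.
split; rewrite !coef_ev ev_ad -?mulNr -!ev_scalef -?ev_addf; apply: eq_ev => -[[] i].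
all: rewrite /bb ?ev_cons ?ev_nil /= ?xpair_eqE /= ?[m + i]addrC ?(inj_eq (addIr m)).
all: by case: (i =P n) => [->|_] /=; rewrite ?(rmorphB, rmorphN) /=; ring.
Qed.

Lemma ad_L_eq0 (K : numClosedFieldType) (half : bool) (lam : K) (x : vec K) :
  (forall m, veq (ad half lam x (GL, m)) [::]) -> veq x [::].
Proof.
move=> h; have coef0 b : coef [::] b = 0 :> K by rewrite coef_ev ev_nil.
have L n := coef_ad_L K half lam x _ n.
have hL g m n : coef (ad half lam x (GL, m)) (g, n + m) = 0 by rewrite h coef0.
(* The factor may vanish for one [m], but its values at [m = 0] and [m = 1] differ by [1 / 2]. *)
have pick (w z : K) : (forall m : int, (w - m%:~R / 2) * z = 0) -> z = 0.
  move=> e; have : z = 2 * ((w - 0%:~R / 2) * z - (w - 1%:~R / 2) * z) by field.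
  by rewrite !e subrr mulr0.
have x0 g n : g = GL \/ g = GI -> coef x (g, n) = 0.
  move=> gE; have e m : (n - m)%:~R * coef x (g, n) = 0.
    by case: (L m n) gE => LL LI _ _ [] ->; rewrite -?LL -?LI hL.
  by have := e (n - 1); rewrite opprB addrC subrK mul1r.
have xG n : coef x (GG, n) = 0.
  by apply: (pick (pv K half n)) => m; case: (L m n) => _ _ <- _; rewrite hL.
have xH n : coef x (GH, n) = 0.
  apply: (pick (pv K half n)) => m; case: (L m n) => _ _ _.
  by rewrite hL xG mulr0 subr0.
by move=> [[] n]; rewrite coef0 ?xG ?xH ?x0 //; auto.
Qed.

(** Both [partialG] and [partialD] kill every [L_m], so [x] commutes with all of them and is zero;
    the images of G at index 0 are then independent. *)
Lemma decomp_direct (K : numClosedFieldType) (half : bool) (lam : K)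
    (x : vec K) (a b : K) :
  lequ (decomp half lam x a b) (lzero K) ->
  [/\ lequ (ad half lam x) (lzero K), a = 0 & b = 0].
Proof.
move=> h; have x0 : veq x [::].
  apply: (@ad_L_eq0 _ half lam) => m; apply/veqP => phi.
  have /veqP/(_ phi) := h (GL, m).
  by rewrite /decomp /ladd /lscale !ev_cat !ev_scale /= !ev_nil !mulr0 !addr0.
have ad0 : lequ (ad half lam x) (lzero K).
  by move=> c; apply/veqP => phi; rewrite ev_ad; move/veqP: x0 => ->; rewrite !ev_nil.
have e (phi : basis -> K) : a * phi (GH, 0) + b * phi (GG, 0) = 0.
  have /veqP/(_ phi) := h (GG, 0); rewrite /decomp /ladd /lscale !ev_cat.
  by have /veqP -> := ad0 (GG, 0); rewrite !ev_scale /= !ev1 ev_nil add0r.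
split=> //.
  by have := e (fun c => (c == (GH, 0))%:R); rewrite eqxx /= mulr1 mulr0 addr0.
by have := e (fun c => (c == (GG, 0))%:R); rewrite eqxx /= mulr1 mulr0 add0r.
Qed.

(** * The degree, and reduction to degree-preserving maps *)

Definition deg (K : numClosedFieldType) (half : bool) (b : basis) : K :=
  b.2%:~R + (if par b then Defs.sval K half else 0).

Lemma deg_bb (K : numClosedFieldType) (half : bool) (lam : K) b c e :
  coef (bb half lam b c) e != 0 -> deg K half e = deg K half b + deg K half c.
Proof.
move/coef_mem; case: b c => [[] m] [[] n]; rewrite /bb /= ?inE //.
all: try (case/orP).
all: move/eqP=> ->; rewrite /deg /= ?rmorphD /=; try ring.
by rewrite /shift /Defs.sval; case: half => /=; field; rewrite ?pnatr_eq0.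
Qed.

(** The functional [phi] composed with [partialG]. *)
Definition nilG {K : numClosedFieldType} (phi : basis -> K) (b : basis) : K :=
  if b.1 == GG then phi (GH, b.2) else 0.

Lemma ev_bb_L0 (K : numClosedFieldType) (half : bool) (lam : K) phi b :
  ev phi (bb half lam (GL, 0) b) = - deg K half b * phi b + lam * nilG phi b.
Proof.
case: b => [[] n]; rewrite /deg /nilG /bb ?ev_cons ?ev_nil /= ?add0r /pv.
all: by rewrite ?rmorphN /=; ring.
Qed.

Lemma ev_bb_L0r (K : numClosedFieldType) (half : bool) (lam : K) phi b :
  ev phi (bb half lam b (GL, 0)) = deg K half b * phi b - lam * nilG phi b.
Proof.
case: b => [[] n]; rewrite /deg /nilG /bb ?ev_cons ?ev_nil /= ?(add0r, addr0) /pv.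
all: by rewrite ?rmorphN /=; ring.
Qed.

Lemma ev_eq0 (K : numClosedFieldType) (phi : basis -> K) (v : vec K) :
  (forall b, coef v b != 0 -> phi b = 0) -> ev phi v = 0.
Proof.
move=> h; have [S ->] := ev_supp _ v; apply: big1 => b _.
by have [->|/h ->] := eqVneq (coef v b) 0; rewrite ?mul0r ?mulr0.
Qed.

Lemma coef_L0 (K : numClosedFieldType) (half : bool) (lam : K) (v : vec K) e :
  ev (fun c => coef (bb half lam (GL, 0) c) e) v =
  - deg K half e * coef v e +
  lam * (if e.1 == GH then coef v (GG, e.2) else 0).
Proof.
have -> : (if e.1 == GH then coef v (GG, e.2) else 0) =
    ev (nilG (fun c => (c == e)%:R)) v.
  case: e => g n /=; case: eqP => [->|ne].
    rewrite coef_ev; apply: eq_ev => -[h m]; rewrite /nilG /= !xpair_eqE.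
    by case: eqP.
  rewrite ev_eq0 // => -[h m] _; rewrite /nilG /= xpair_eqE.
  by case: eqP => // _; case: eqP => // e; case: ne.
rewrite coef_ev -!ev_scalef -ev_addf; apply: eq_ev => c.
rewrite coef_ev ev_bb_L0; congr (_ + _).
by case: eqP => [->|_] //; rewrite !mulr0.
Qed.

(* Comparing components in [D [L_0, b] = [D L_0, b] + [L_0, D b]]: [ad L_0] is
   the negated degree up to the nilpotent map [lam * partialG], so components of
   nonzero degree vanish, first off the image and kernel of [partialG]. *)
Lemma bder_deg0 (K : numClosedFieldType) (half : bool) (lam : K) a (D : lmap K) :
  bder half lam a D ->
  (forall e, coef (D (GL, 0)) e != 0 -> deg K half e = 0) ->
  forall b e, coef (D b) e != 0 -> deg K half e = deg K half b.
Proof.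
move=> [_ D2] h.
have key b e : deg K half e != deg K half b ->
    (deg K half e - deg K half b) * coef (D b) e =
    lam * ((if e.1 == GH then coef (D b) (GG, e.2) else 0) -
           (if b.1 == GG then coef (D (GH, b.2)) e else 0)).
  move=> ne; have := D2 (GL, 0) b (fun c => (c == e)%:R).
  rewrite andbF mul1r ev_bb_L0 -coef_ev.
  (* By [h], [D L_0] has degree 0, so [[D L_0, b]] has the degree of [b] and no component at [e]. *)
  rewrite [X in _ = X + _]ev_eq0 => [|c /h dc]; last first.
    rewrite -coef_ev; apply/eqP; apply: contraNT ne => /deg_bb ->.
    by rewrite dc add0r.
  under [X in _ = _ + X]eq_ev do rewrite -coef_ev.
  rewrite coef_L0 add0r /nilG -coef_ev => E.
  apply/eqP; rewrite -subr_eq0; move/eqP: E; rewrite -subr_eq0 => /eqP E.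
  by apply/eqP; apply: etrans E; ring.
have gen b e : deg K half e != deg K half b ->
    (e.1 == GH -> coef (D b) (GG, e.2) = 0) ->
    (b.1 == GG -> coef (D (GH, b.2)) e = 0) -> coef (D b) e = 0.
  move=> ne h1 h2; apply/eqP; move/eqP: (key _ _ ne).
  have -> : (if e.1 == GH then coef (D b) (GG, e.2) else 0) = 0.
    by case: ifP => // /h1.
  have -> : (if b.1 == GG then coef (D (GH, b.2)) e else 0) = 0.
    by case: ifP => // /h2.
  by rewrite subrr mulr0 mulf_eq0 subr_eq0 (negPf ne).
have degG n : deg K half (GG, n) = deg K half (GH, n) by [].
(* Each correction term falls under a case already settled: [s1] has none, [s2] and [s3] have at
   most one, the last case may have both. *)
have s1 b e : deg K half e != deg K half b -> b.1 != GG -> e.1 != GH ->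
    coef (D b) e = 0.
  by move=> ne /negPf b1 /negPf e1; apply: gen; rewrite ?b1 ?e1.
have s2 b e : deg K half e != deg K half b -> e.1 != GH -> coef (D b) e = 0.
  case: b => g n ne e1; apply: (gen _ _ ne) => /= [|/eqP gE]; first by rewrite (negPf e1).
  by rewrite gE in ne; apply: s1.
have s3 b e : deg K half e != deg K half b -> b.1 != GG -> coef (D b) e = 0.
  case: e => g n ne b1; apply: (gen _ _ ne) => /= [/eqP gE|]; last by rewrite (negPf b1).
  by rewrite gE in ne; apply: s2.
move=> b e nz; apply/eqP; apply: contraNT nz => ne; apply/eqP.
case: b e ne => g n [k m] ne; apply: (gen _ _ ne) => /= /eqP gE; rewrite gE in ne.
  exact: s2.
exact: s3.
Qed.

Lemma coef_filter (K : numClosedFieldType) (P : pred basis) (v : vec K) e :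
  coef [seq t <- v | P t.2] e = if P e then coef v e else 0.
Proof.
rewrite /coef big_filter_cond big_mkcond [X in if _ then X else _]big_mkcond /=.
case: ifP => Pe.
  by apply: eq_bigr => t _; case: (t.2 =P e) => [->|_]; rewrite ?Pe ?andbF.
by apply: big1 => t _; case: (t.2 =P e) => [->|_]; rewrite ?Pe ?andbF.
Qed.

(* [(n - lam N)^-1 = n^-1 + lam n^-2 N] for [N = partialG], as [N \o N = 0]. *)
Definition L0inv {K : numClosedFieldType} (half : bool) (lam : K)
    (t : K * basis) : vec K :=
  (t.1 / deg K half t.2, t.2) ::
  (if t.2.1 == GG then [:: (lam * t.1 / deg K half t.2 ^+ 2, (GH, t.2.2))]
   else [::]).

Lemma ev_L0inv (K : numClosedFieldType) (half : bool) (lam : K) phi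
    (t : K * basis) :
  deg K half t.2 != 0 ->
  ev (fun c => ev phi (bb half lam c (GL, 0))) (L0inv half lam t) =
  t.1 * phi t.2.
Proof.
case: t => k [g n] /= nz; rewrite /L0inv ev_cons ev_bb_L0r /nilG /=.
case: (g =P GG) nz => [->|_] nz; last by rewrite ev_nil; field.
rewrite ev_cons ev_nil ev_bb_L0r /nilG /=.
have -> : deg K half (GH, n) = deg K half (GG, n) by [].
by field.
Qed.

(** The part of [D L_0] in nonzero degrees equals [[x, L_0]] for an [x] obtained termwise from
    [L0inv]; subtracting [ad x] removes it. *)
Lemma exists_deg0 (K : numClosedFieldType) (half : bool) (lam : K) a (D : lmap K) :
  bder half lam a D ->
  exists x, bder half lam a (ladd D (ad half lam x)) /\
  forall b e, coef (ladd D (ad half lam x) b) e != 0 ->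
    deg K half e = deg K half b.
Proof.
(* The formal sum [D L_0] may list vectors of the wrong parity that cancel; the parity test drops
   them so that [x] is termwise homogeneous. *)
move=> Dd; pose P e := (par e == a) && (deg K half e != 0).
pose y := [seq t <- D (GL, 0) | P t.2].
pose x := flatten [seq L0inv half lam t | t <- y].
have xpar : all (fun t => par t.2 == a) (vscale (-1) x).
  rewrite all_map; apply/allP => s /flattenP[l /mapP[[k [g n]] ty ->]].
  move: ty; rewrite mem_filter /L0inv /= => /andP[/andP[/= pa _] _].
  rewrite inE => /predU1P[->//|]; case: (g =P GG) => // gE.
  by rewrite inE => /eqP ->; move: pa; rewrite gE.
have D'd := bder_add _ _ _ _ _ _ Dd (bder_ad _ half lam _ _ xpar).
exists (vscale (-1) x); split=> //; apply: (bder_deg0 _ _ _ _ _ D'd) => e nz.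
apply/eqP; apply: contraNT nz => de; apply/eqP.
rewrite coef_ev ev_cat ev_ad ev_scale -coef_ev.
suff -> : ev (fun c => ev (fun b => (b == e)%:R) (bb half lam c (GL, 0))) x =
    coef y e.
  rewrite coef_filter /P de andbT; case: Dd => /(_ (GL, 0)) pe _.
  case: eqP => pa; first by ring.
  have [->|/pe] := eqVneq (coef (D (GL, 0)) e) 0; first by ring.
  by move/pa.
have := filter_all (P \o snd) (D (GL, 0)); rewrite -/y coef_ev /x {x xpar D'd}.
elim: y => [|t y IH] /=; first by rewrite !ev_nil.
move=> /andP[/andP[_ dt]] /IH IHy.
by rewrite -cat_cons -/(L0inv _ _ _) ev_cat [RHS]ev_cons -IHy ev_L0inv.
Qed.

(** The integer label is kept, not the degree: for homogeneous maps the two conditions agree unless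
    the map is odd and [s = 1/2]. *)
Definition diag {K : numClosedFieldType} (D : lmap K) : Prop :=
  forall b e, coef (D b) e != 0 -> e.2 = b.2.

Lemma two_pv (K : numClosedFieldType) half n :
  2 * pv K half n = (2 * n + shift half)%:~R.
Proof.
by rewrite /pv /Defs.sval /shift; case: half; rewrite rmorphD rmorphM /=; field;
  rewrite ?pnatr_eq0.
Qed.

Lemma deg_diag (K : numClosedFieldType) (half : bool) (lam : K) a (D : lmap K) :
  bder half lam a D -> a && half = false ->
  (forall b e, coef (D b) e != 0 -> deg K half e = deg K half b) -> diag D.
Proof.
move=> [D1 _] ah h b e nz; apply: (@intr_inj K).
have := h _ _ nz; have := D1 _ _ nz; rewrite /deg => ->.
case: a half ah {D1 h} => [] [] //= _; rewrite ?addbF; last by case: ifP => _; apply: addIr.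
  by rewrite /Defs.sval !if_same !addr0.
by apply: addIr.
Qed.

(** An odd map exchanges vectors of integral degree with vectors of half-integral degree; doubling
    turns equality of degrees into a parity contradiction. *)
Lemma deg_odd_half (K : numClosedFieldType) (lam : K) (D : lmap K) :
  bder true lam true D ->
  (forall b e, coef (D b) e != 0 -> deg K true e = deg K true b) ->
  lequ D (lzero K).
Proof.
move=> [D1 _] h b e; rewrite [RHS]coef_ev ev_nil; apply/eqP; apply/negPn/negP => nz.
have := h _ _ nz; have := D1 _ _ nz; rewrite /deg addbT => ->.
move/(congr1 (fun z : K => 2 * z)); rewrite !mulrDr; case: (par b) => /= E.
  have : (2 * e.2 - (2 * b.2 + 1))%:~R = 0 :> K.
    by rewrite -(subrr (2 * e.2%:~R + 2 * 0)) {2}E; field; rewrite ?pnatr_eq0.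
  by move/eqP; rewrite intr_eq0 => /eqP; lia.
have : (2 * b.2 - (2 * e.2 + 1))%:~R = 0 :> K.
  by rewrite -(subrr (2 * e.2%:~R + 2 * 2^-1)) {1}E; field; rewrite ?pnatr_eq0.
by move/eqP; rewrite intr_eq0 => /eqP; lia.
Qed.

(** Through this a homogeneous [diag] map becomes a few scalar functions of the index, two per kind
    of basis vector. *)
Lemma ev_diag (K : numClosedFieldType) a (v : vec K) m phi :
  vpar a v -> (forall e, coef v e != 0 -> e.2 = m) ->
  ev phi v =
  coef v (if a then GG else GL, m) * phi (if a then GG else GL, m) +
  coef v (if a then GH else GI, m) * phi (if a then GH else GI, m).
Proof.
move=> va vm; set g := if a then GG else GL; set h := if a then GH else GI.
have /veqP -> : veq v [:: (coef v (g, m), (g, m)); (coef v (h, m), (h, m))].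
  move=> [k n]; rewrite [RHS]coef_ev !ev_cons ev_nil /= addr0 !xpair_eqE.
  case: (m =P n) => [<-|ne]; rewrite ?andbT ?andbF.
    have [e|/va] := eqVneq (coef v (k, m)) 0.
      by rewrite /g /h; case: a k e {va g h} => [] [] /= e; rewrite ?e; ring.
    by rewrite /g /h; case: a k {va g h} => [] [] //= _; ring.
  have [->|/vm] := eqVneq (coef v (k, n)) 0; first by rewrite !mulr0 addr0.
  by move=> nm; case: ne.
by rewrite !ev_cons ev_nil addr0.
Qed.

(** * Scalar recurrences from the brackets *)

Lemma int_const (T : Type) (f : int -> T) :
  (forall m, f (m + 1) = f m) -> forall m, f m = f 0.
Proof.
move=> h; elim/int_ind => // n IH.
  by rewrite -IH -(h n%:Z); congr f; lia.
by rewrite -IH -(h (- n.+1%:Z)); congr f; lia.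
Qed.

Lemma intr_cancel (K : numClosedFieldType) (n : int) (z : K) :
  n != 0 -> n%:~R * z = 0 -> z = 0.
Proof. by move=> nz /eqP; rewrite mulf_eq0 intr_eq0 (negPf nz) => /eqP. Qed.

(** Off the diagonal [m = n] the function is additive, so it is governed by [f 1]. *)
Lemma witt_cocycle_even (K : numClosedFieldType) (f : int -> K) :
  (forall m n, (m - n)%:~R * f (m + n) = (m - n)%:~R * (f m + f n)) ->
  f 1 = 0 -> forall m, f m = 0.
Proof.
move=> h f1.
have {}h m n : m != n -> f (m + n) = f m + f n.
  by move=> ne; apply: (mulfI _ (h m n)); rewrite intr_eq0 subr_eq0.
have f0 : f 0 = 0 by have := h 1 0 isT; rewrite addr0 f1 add0r.
have fN : f (-1) = 0 by have := h 1 (-1) isT; rewrite subrr f1 f0 add0r.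
move=> m; rewrite -f0; apply: int_const => {}m.
(* Splitting [m] as [(m + 1) + (-1)] needs [m + 1 != -1]; at [m = -2] adding 1 works instead. *)
case: (m =P -2) => [->|ne]; first by rewrite h // f1 addr0.
by rewrite -[in RHS](addrK 1 m) [RHS]h ?fN ?addr0 //; lia.
Qed.

(** Pairing with index [-1] or [1], where [f] is already zero, gives a one-step recurrence whose
    leading factor is odd, hence nonzero. *)
Lemma witt_cocycle_odd (K : numClosedFieldType) (f : int -> K) :
  (forall m n, (m - n)%:~R * f (m + n) =
     (m%:~R - n%:~R / 2) * f m + (m%:~R / 2 - n%:~R) * f n) ->
  f 1 = 0 -> forall m, f m = 0.
Proof.
move=> h f1.
have {}h m n : (2 * (m - n))%:~R * f (m + n) =
    (2 * m - n)%:~R * f m + (m - 2 * n)%:~R * f n.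
  by rewrite rmorphM /= -mulrA h ?(rmorphB, rmorphM) /=; field; rewrite ?pnatr_eq0.
have f0 : f 0 = 0.
  have := h 1 0; rewrite addr0 f1 !mulr0 add0r => /esym; exact: intr_cancel.
have fN : f (-1) = 0.
  have := h 1 (-1); rewrite subrr f1 f0 !mulr0 add0r => /esym; exact: intr_cancel.
elim/int_ind => // n IH.
  have := h (n.+1 : int) (-1); rewrite fN (_ : n.+1%:Z + -1 = n); last lia.
  by rewrite IH !mulr0 addr0 => /esym; apply: intr_cancel; lia.
have := h (- (n.+1%:Z)) 1; rewrite f1 (_ : - n.+1%:Z + 1 = - n%:Z); last lia.
by rewrite IH !mulr0 addr0 => /esym; apply: intr_cancel; lia.
Qed.

(** With [r = m + p] the factor is [r - (3 * p + shift half)], which cannot vanish at both [p = 0]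
    and [p = 1]. *)
Lemma eq0_IG (K : numClosedFieldType) half (f : int -> K) :
  (forall m p, (m%:~R - 2 * pv K half p) * f (m + p) = 0) ->
  forall r, f r = 0.
Proof.
move=> h r; have {}h p : (r - (3 * p + shift half))%:~R * f r = 0.
  have := h (r - p) p; rewrite two_pv subrK -rmorphB /= => <-.
  by congr (_%:~R * _); ring.
case: (r =P shift half) => [e|ne].
  by apply: intr_cancel (h 1); rewrite e; lia.
by apply: intr_cancel (h 0); lia.
Qed.

(** All terms of a relation for a [diag] map share one index, so forgetting the index still isolates
    one coordinate and avoids comparing indices. *)
Definition kindf (K : numClosedFieldType) (g : gen) (b : basis) : K :=
  match b.1, g with
  | GL, GL | GI, GI | GG, GG | GH, GH => 1
  | _, _ => 0 end.

Lemma diag_add (K : numClosedFieldType) (D E : lmap K) :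
  diag D -> diag E -> diag (ladd D E).
Proof.
move=> dD dE b e; rewrite coef_ev ev_cat -!coef_ev.
have [->|/dD //] := eqVneq (coef (D b) e) 0.
by rewrite add0r => /dE.
Qed.

Lemma diag_all (K : numClosedFieldType) (D : lmap K) :
  (forall b, all (fun x => x.2.2 == b.2) (D b)) -> diag D.
Proof. by move=> h b e /coef_mem /mapP[x xD ->]; apply/eqP/(allP (h b)). Qed.

Lemma linear_combination (R : pzRingType) (k x y z w : R) :
  x = y -> z - w = k * (x - y) -> z = w.
Proof. by move=> ->; rewrite subrr mulr0 => /subr0_eq. Qed.

Ltac fieldK := field; rewrite ?pnatr_eq0 //.

(** * Normalisation on the Witt part *)

Lemma bder_even_L (K : numClosedFieldType) (half : bool) (lam : K) (D : lmap K) :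
  bder half lam false D -> diag D ->
  coef (D (GL, 1)) (GL, 1) = 0 -> coef (D (GL, 1)) (GI, 1) = 0 ->
  forall m phi, ev phi (D (GL, m)) = 0.
Proof.
move=> [D1 D2] dD L1 I1.
pose a m := coef (D (GL, m)) (GL, m); pose b m := coef (D (GL, m)) (GI, m).
have DL m phi : ev phi (D (GL, m)) = a m * phi (GL, m) + b m * phi (GI, m).
  exact: (ev_diag _ _ _ m phi (D1 (GL, m)) (dD (GL, m))).
have E m n g := D2 (GL, m) (GL, n) (kindf K g).
rewrite /bb /= in E.
have a0 : forall m, a m = 0.
  apply: witt_cocycle_even L1 => m n; have := E m n GL.
  rewrite !DL !ev_cons !ev_nil !DL /kindf /=.
  move=> /(linear_combination _ 1); apply.
  by ring.
have b0 : forall m, b m = 0.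
  apply: witt_cocycle_even I1 => m n; have := E m n GI.
  rewrite !DL !ev_cons !ev_nil !DL /kindf /=.
  move=> /(linear_combination _ 1); apply.
  by ring.
by move=> m phi; rewrite DL a0 b0 !mul0r addr0.
Qed.

Lemma bder_odd_L (K : numClosedFieldType) (lam : K) (D : lmap K) :
  bder false lam true D -> diag D ->
  coef (D (GL, 1)) (GG, 1) = 0 -> coef (D (GL, 1)) (GH, 1) = 0 ->
  forall m phi, ev phi (D (GL, m)) = 0.
Proof.
move=> [D1 D2] dD G1 H1.
pose a m := coef (D (GL, m)) (GG, m); pose b m := coef (D (GL, m)) (GH, m).
have DL m phi : ev phi (D (GL, m)) = a m * phi (GG, m) + b m * phi (GH, m).
  exact: (ev_diag _ _ _ m phi (D1 (GL, m)) (dD (GL, m))).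
have E m n g := D2 (GL, m) (GL, n) (kindf K g).
rewrite /bb /= in E.
have a0 : forall m, a m = 0.
  apply: witt_cocycle_odd G1 => m n; have := E m n GG.
  rewrite !DL !ev_cons !ev_nil !DL /kindf /pv /=.
  move=> /(linear_combination _ 1); apply.
  by fieldK.
(* This comes after [a0] because the [lam] term feeds the G-part into the H-equation. *)
have b0 : forall m, b m = 0.
  apply: witt_cocycle_odd H1 => m n; have := E m n GH.
  rewrite !DL !ev_cons !ev_nil !DL !a0 /kindf /pv /=.
  move=> /(linear_combination _ 1); apply.
  by fieldK.
by move=> m phi; rewrite DL a0 b0 !mul0r addr0.
Qed.

Lemma normalize_even (K : numClosedFieldType) (half : bool) (lam : K)
    (D : lmap K) :
  bder half lam false D -> diag D ->
  exists x, [/\ bder half lam false (ladd D (ad half lam x)),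
    diag (ladd D (ad half lam x)) &
    forall m phi, ev phi (ladd D (ad half lam x) (GL, m)) = 0].
Proof.
(* [[L_0, L_1] = - L_1] and [[I_0, L_1] = - I_1]. *)
move=> Dd dD; pose x : vec K := [:: (coef (D (GL, 1)) (GL, 1), (GL, 0));
                                    (coef (D (GL, 1)) (GI, 1), (GI, 0))].
have D'd : bder half lam false (ladd D (ad half lam x)).
  by apply: bder_add Dd _; apply: bder_ad.
have dD' : diag (ladd D (ad half lam x)).
  apply: diag_add dD _; apply: diag_all => -[[] n] /=;
    by rewrite ?add0r ?addr0 ?eqxx.
exists x; split=> //; have [EL EI _ _] := coef_ad_L K half lam x 1 0.
apply: bder_even_L D'd dD' _ _; rewrite coef_ev ev_cat -!coef_ev.
  by rewrite EL [coef x _]coef_ev !ev_cons ev_nil /= sub0r; ring.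
by rewrite EI [coef x _]coef_ev !ev_cons ev_nil /= sub0r; ring.
Qed.

Lemma normalize_odd (K : numClosedFieldType) (lam : K) (D : lmap K) :
  bder false lam true D -> diag D ->
  exists x, [/\ bder false lam true (ladd D (ad false lam x)),
    diag (ladd D (ad false lam x)) &
    forall m phi, ev phi (ladd D (ad false lam x) (GL, m)) = 0].
Proof.
move=> Dd dD; pose a := coef (D (GL, 1)) (GG, 1).
pose b := coef (D (GL, 1)) (GH, 1).
(* [[G_0, L_1] = - G_1 / 2 - 2 lam H_1] and [[H_0, L_1] = - H_1 / 2]; the term [8 * lam * a] offsets
   the H-part coming from [2 a G_0]. *)
pose x : vec K := [:: (2 * a, (GG, 0)); (2 * b - 8 * lam * a, (GH, 0))].
have D'd : bder false lam true (ladd D (ad false lam x)).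
  by apply: bder_add Dd _; apply: bder_ad.
have dD' : diag (ladd D (ad false lam x)).
  apply: diag_add dD _; apply: diag_all => -[[] n] /=;
    by rewrite ?add0r ?addr0 ?eqxx.
exists x; split=> //; have [_ _ EG EH] := coef_ad_L K false lam x 1 0.
have xG : coef x (GG, 0) = 2 * a by rewrite coef_ev !ev_cons ev_nil /=; ring.
have xH : coef x (GH, 0) = 2 * b - 8 * lam * a.
  by rewrite coef_ev !ev_cons ev_nil /=; ring.
apply: bder_odd_L D'd dD' _ _; rewrite coef_ev ev_cat -!coef_ev.
  by rewrite EG xG -/a /pv /=; fieldK.
by rewrite EH xG xH -/b /pv /=; fieldK.
Qed.

(** * Maps killing all [L_m] *)

(** The brackets are used in turn: [[L, I]] makes [c], [d] constant, [[I, I] = 0] kills [c],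
    [[G, G]] gives [e], [[I, G]] gives [g] and [h], and [[L, G]] gives [lam * d 0 = 0] and the
    constancy of [f]. *)
Lemma bder_even_solve (K : numClosedFieldType) (half : bool) (lam : K)
    (D : lmap K) :
  bder half lam false D -> diag D ->
  (forall m phi, ev phi (D (GL, m)) = 0) ->
  exists k l, (lam != 0 -> l = 0) /\ lequ D (decomp half lam [::] k l).
Proof.
move=> [D1 D2] dD DL.
pose c m := coef (D (GI, m)) (GL, m); pose d m := coef (D (GI, m)) (GI, m).
pose e m := coef (D (GG, m)) (GG, m); pose f m := coef (D (GG, m)) (GH, m).
pose g m := coef (D (GH, m)) (GG, m); pose h m := coef (D (GH, m)) (GH, m).
have DI m phi : ev phi (D (GI, m)) = c m * phi (GL, m) + d m * phi (GI, m).
  exact: (ev_diag _ _ _ m phi (D1 (GI, m)) (dD (GI, m))).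
have DG m phi : ev phi (D (GG, m)) = e m * phi (GG, m) + f m * phi (GH, m).
  exact: (ev_diag _ _ _ m phi (D1 (GG, m)) (dD (GG, m))).
have DH m phi : ev phi (D (GH, m)) = g m * phi (GG, m) + h m * phi (GH, m).
  exact: (ev_diag _ _ _ m phi (D1 (GH, m)) (dD (GH, m))).
have E g1 m g2 n k := D2 (g1, m) (g2, n) (kindf K k).
have cst (z : int -> K) : (forall m : int, m%:~R * (z m - z 0) = 0) ->
    forall m, z m = z 0.
  move=> zh m; have [->//|m0] := eqVneq m 0.
  exact/subr0_eq/(intr_cancel _ m).
have cE : forall m, c m = c 0.
  apply: cst => m; have := E GL m GI 0 GL; rewrite /bb ?addr0.
  rewrite !DL !DI !ev_cons !ev_nil !DI /kindf /=.
  move=> /(linear_combination _ 1); apply.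
  by rewrite ?addr0 ?subr0; ring.
have dE : forall m, d m = d 0.
  apply: cst => m; have := E GL m GI 0 GI; rewrite /bb ?addr0.
  rewrite !DL !DI !ev_cons !ev_nil !DI /kindf /=.
  move=> /(linear_combination _ 1); apply.
  by rewrite ?addr0 ?subr0; ring.
have c0 m : c m = 0.
  rewrite cE; have := E GI 1 GI 0 GI; rewrite /bb !DI !ev_cons !ev_nil /kindf /=.
  rewrite (cE 1) => /esym /(linear_combination _ 2^-1); apply.
  by fieldK.
have eE p : e p = d 0 / 2.
  have := E GG p GG p GI; rewrite /bb !DG !ev_cons !ev_nil !DI dE /kindf /=.
  move=> /esym /(linear_combination _ 2^-1); apply.
  by fieldK.
have g0 : forall r, g r = 0.
  apply: (eq0_IG _ half) => m p; have := E GI m GG p GG.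
  rewrite /bb !DI !DG !ev_cons !ev_nil !DH c0 /kindf /= => /(linear_combination _ 1).
  by apply; ring.
have hE r : h r = 3 / 2 * d 0.
  apply: subr0_eq; move: r; apply: (eq0_IG _ half) => m p; have := E GI m GG p GH.
  rewrite /bb !DI !DG !ev_cons !ev_nil !DH c0 dE eE /kindf /=.
  by move=> /(linear_combination _ 1); apply; fieldK.
have LG m p : (m%:~R / 2 - pv K half p) * (f (m + p) - f p) +
    lam * (m%:~R + 1) * d 0 = 0.
  have := E GL m GG p GH.
  rewrite /bb !DL !DG !ev_cons !ev_nil !DG !DH !eE hE /kindf /=.
  by move=> /(linear_combination _ 1); apply; fieldK.
have ld : lam * d 0 = 0 by have := LG 0 0; rewrite addr0 subrr => <-; ring.
have fstep m p : (m - (2 * p + shift half))%:~R * (f (m + p) - f p) = 0.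
  have := LG m p; rewrite mulrAC ld mul0r addr0 rmorphB /= -two_pv => E1.
  by apply: (linear_combination _ 2 _ _ _ _ E1); fieldK.
have fE r : f r = f 0.
  (* Going from index 0 to [r] has factor [r - shift half]; when this vanishes and [s = 1/2], the
     step from [r = 1] back to 0 has factor [-4]. *)
  have [rs|ne] := eqVneq r (shift half); last first.
    have := fstep r 0; rewrite addr0 => /intr_cancel/subr0_eq; apply.
    by rewrite subr_eq0 mulr0 add0r.
  have := fstep (- r) r; rewrite addNr rs; case: (half) => //= E1.
  by apply/esym/subr0_eq; apply: intr_cancel E1.
(* The coefficient of [partialD] is the eigenvalue [e] on G. *)
exists (f 0), (d 0 / 2); split.
  by move=> l0; move/eqP: ld; rewrite mulf_eq0 (negPf l0) => /eqP ->; rewrite mul0r.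
move=> [[] m]; apply/veqP => phi.
all: rewrite /decomp /ladd /lscale !ev_cat !ev_scale ?ev_ad ?ev_nil /=.
all: rewrite /partialD /= ?ev_cons ?ev_nil ?(DL, DI, DG, DH)
  ?(c0, dE, eE, fE, g0, hE) /=.
all: by fieldK.
Qed.

(** [[L, I]] forces [D] to vanish on I, then [[G, G]] on G, then [[I, G]] on H. *)
Lemma bder_odd_solve (K : numClosedFieldType) (lam : K) (D : lmap K) :
  bder false lam true D -> diag D ->
  (forall m phi, ev phi (D (GL, m)) = 0) -> lequ D (lzero K).
Proof.
move=> [D1 D2] dD DL.
pose c m := coef (D (GI, m)) (GG, m); pose d m := coef (D (GI, m)) (GH, m).
pose e m := coef (D (GG, m)) (GL, m); pose f m := coef (D (GG, m)) (GI, m).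
pose g m := coef (D (GH, m)) (GL, m); pose h m := coef (D (GH, m)) (GI, m).
have DI m phi : ev phi (D (GI, m)) = c m * phi (GG, m) + d m * phi (GH, m).
  exact: (ev_diag _ _ _ m phi (D1 (GI, m)) (dD (GI, m))).
have DG m phi : ev phi (D (GG, m)) = e m * phi (GL, m) + f m * phi (GI, m).
  exact: (ev_diag _ _ _ m phi (D1 (GG, m)) (dD (GG, m))).
have DH m phi : ev phi (D (GH, m)) = g m * phi (GL, m) + h m * phi (GI, m).
  exact: (ev_diag _ _ _ m phi (D1 (GH, m)) (dD (GH, m))).
have E g1 m g2 n k := D2 (g1, m) (g2, n) (kindf K k).
have LI (z : int -> K) : (forall m n,
    (m - n)%:~R * z (m + n) = (m%:~R / 2 - n%:~R) * z n) -> forall m, z m = 0.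
  (* The two instances read [z 1 = 4/3 z 0] and [z 1 = z 0 / 2]; eliminating [z 1] leaves
     [-5 * z 0 = 0]. *)
  move=> zh; have z0 : z 0 = 0.
    have := zh (-1) 1; rewrite addNr => E1; have := zh 1 0; rewrite addr0 => E2.
    apply: (intr_cancel _ (-5)) => //.
    apply: (linear_combination _ 4 _ _ _ _ E1).
    by apply: (linear_combination _ (-6) _ _ _ _ E2); fieldK.
  move=> m; have [->//|m0] := eqVneq m 0.
  by have := zh m 0; rewrite z0 mulr0 ?subr0 ?addr0 => /intr_cancel; apply.
have c0 : forall m, c m = 0.
  apply: LI => m n; have := E GL m GI n GG.
  rewrite /bb !DL !DI !ev_cons !ev_nil !DI /kindf /pv /=.
  by move=> /(linear_combination _ 1); apply; fieldK.
have d0 : forall m, d m = 0.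
  apply: LI => m n; have := E GL m GI n GH.
  rewrite /bb !DL !DI !ev_cons !ev_nil !DI !c0 /kindf /pv /=.
  by move=> /(linear_combination _ 1); apply; fieldK.
have GGz (z : int -> K) : (forall p q : int,
    (p - 2 * q)%:~R * z p + (q - 2 * p)%:~R * z q = 0) -> forall p, z p = 0.
  (* Setting [q = p] settles [p != 0]; the pair [(0, 1)] then settles index 0. *)
  move=> zh; have zn p : p != 0 -> z p = 0.
    move=> p0; apply: (intr_cancel _ (- 2 * p)); first by lia.
    by apply: (linear_combination _ 1 _ _ _ _ (zh p p)); ring.
  move=> p; have [->|/zn //] := eqVneq p 0.
  apply: (intr_cancel _ (-2)) => //.
  by apply: (linear_combination _ 1 _ _ _ _ (zh 0 1)); rewrite (zn 1) //; ring.
have e0 : forall m, e m = 0.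
  apply: GGz => p q; have := E GG p GG q GG.
  rewrite /bb !DG !ev_cons !ev_nil !DI c0 /kindf /pv /=.
  by move=> /esym /(linear_combination _ 2); apply; fieldK.
have f0 : forall m, f m = 0.
  apply: GGz => p q; have := E GG p GG q GH.
  rewrite /bb !DG !ev_cons !ev_nil !DI d0 !e0 /kindf /pv /=.
  by move=> /esym /(linear_combination _ 1); apply; fieldK.
have g0 : forall r, g r = 0.
  apply: (eq0_IG _ false) => m p; have := E GI m GG p GL.
  rewrite /bb !DI !DG !ev_cons !ev_nil !DH c0 d0 e0 f0 /kindf /=.
  by move=> /(linear_combination _ 1); apply; ring.
have h0 : forall r, h r = 0.
  apply: (eq0_IG _ false) => m p; have := E GI m GG p GI.
  rewrite /bb !DI !DG !ev_cons !ev_nil !DH c0 d0 e0 f0 /kindf /=.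
  by move=> /(linear_combination _ 1); apply; ring.
move=> [[] m]; apply/veqP => phi; rewrite ?(DL, DI, DG, DH) ev_nil //.
all: by rewrite ?(c0, d0, e0, f0, g0, h0) !mul0r addr0.
Qed.

(** * Assembling the classification *)

Lemma lequ_sub_ad (K : numClosedFieldType) (half : bool) (lam : K)
    (D : lmap K) x y k l :
  lequ (ladd D (ad half lam x)) (decomp half lam y k l) ->
  lequ D (decomp half lam (y ++ vscale (-1) x) k l).
Proof.
move=> h b; apply/veqP => phi; have /veqP/(_ phi) := h b.
rewrite /decomp /ladd !ev_cat !ev_ad ev_cat ev_scale.
by move=> /(linear_combination _ 1); apply; ring.
Qed.

Lemma lzero_decomp (K : numClosedFieldType) (half : bool) (lam : K) (D : lmap K) :
  lequ D (lzero K) -> lequ D (decomp half lam [::] 0 0).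
Proof.
move=> h b; apply/veqP => phi; have /veqP -> := h b.
by rewrite /decomp /ladd !ev_cat ev_ad !ev_scale !ev_nil !mul0r !addr0.
Qed.

Lemma bder_classify (K : numClosedFieldType) (half : bool) (lam : K) a
    (D : lmap K) : bder half lam a D ->
  exists x k l, (lam != 0 -> l = 0) /\ lequ D (decomp half lam x k l).
Proof.
move=> Dd; have [x [D'd degD']] := exists_deg0 _ _ _ _ _ Dd.
suff [y [k [l [kl E]]]] : exists y k l, (lam != 0 -> l = 0) /\
    lequ (ladd D (ad half lam x)) (decomp half lam y k l).
  by exists (y ++ vscale (-1) x), k, l; split=> //; apply: lequ_sub_ad.
move: {D Dd x} (ladd _ _) D'd degD' => D Dd degD.
(* For odd [D] and [s = 1/2] the degree-preserving remainder is zero, so the original map is already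
   inner. *)
have [ah|ah] := boolP (a && half).
  case/andP: ah Dd degD => -> -> Dd degD; exists [::], 0, 0; split=> //.
  by apply: lzero_decomp; apply: deg_odd_half Dd degD.
have dD : diag D by apply: deg_diag Dd _ degD; apply/negbTE.
case: a ah Dd => /= [hF|_] Dd; last first.
  have [x [D'd dD' D'L]] := normalize_even _ _ _ _ Dd dD.
  have [k [l [kl E]]] := bder_even_solve _ _ _ _ D'd dD' D'L.
  by exists ([::] ++ vscale (-1) x), k, l; split=> //; apply: lequ_sub_ad.
rewrite (negbTE hF) in Dd *.
have [x [D'd dD' D'L]] := normalize_odd _ _ _ Dd dD.
exists ([::] ++ vscale (-1) x), 0, 0; split=> //.
by apply/lequ_sub_ad/lzero_decomp; apply: bder_odd_solve D'd dD' D'L.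
Qed.

Lemma isDer_classify (K : numClosedFieldType) (half : bool) (lam : K)
    (D : lmap K) : isDer half lam D ->
  exists x k l, (lam != 0 -> l = 0) /\ lequ D (decomp half lam x k l).
Proof.
move=> [D0 [D1 [/superderP/bder_classify[x0 [k0 [l0 [h0 E0]]]]]]].
move=> [/superderP/bder_classify[x1 [k1 [l1 [h1 E1]]]] E].
exists (x0 ++ x1), (k0 + k1), (l0 + l1); split=> [ln|b].
  by rewrite h0 ?h1 ?addr0.
apply/veqP => phi; have /veqP -> := E b; rewrite ev_cat.
have /veqP -> := E0 b; have /veqP -> := E1 b.
by rewrite /decomp /ladd /lscale !ev_cat !ev_ad !ev_cat !ev_scale; ring.
Qed.

(* half = true  <->  s = 1/2 ;  half = false  <->  s = 0.
   Der(L) = Inn(L) (+) K partial_G (+) delta_{lam,0} K partial_D :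
   (1) every such sum is a superderivation, (2) every superderivation
   is such a sum, (3) the sum is direct. *)
Theorem theorem2p1 (K : numClosedFieldType) (half : bool) (lam : K) :
  [/\ (forall (x : vec K) (a b : K), (lam != 0 -> b = 0) ->
         isDer half lam (decomp half lam x a b)),
      (forall D : lmap K, isDer half lam D ->
         exists (x : vec K) (a b : K), (lam != 0 -> b = 0) /\
           lequ D (decomp half lam x a b))
    & (forall (x : vec K) (a b : K), (lam != 0 -> b = 0) ->
         lequ (decomp half lam x a b) (lzero K) ->
         [/\ lequ (ad half lam x) (lzero K), a = 0 & b = 0])].
Proof.
split=> [x a b|D|x a b _]; first exact: isDer_decomp.
  exact: isDer_classify.
exact: decomp_direct.
Qed.
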